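(* $\mathrm{cof}(f\mathcal{N}(\mathrm{Fin}))\leq\mathfrak{d}$.
   Context: $\exists^\infty n$ means ''for infinitely many $n\in\omega$'', $\forall^\infty n$ means ''for all but finitely many $n\in\omega$''. A subset $F\subseteq\omega^\omega$ belongs to $f\mathcal{N}(\mathrm{Fin})$ if there is a sequence $(S_n)_{n\in\omega}$ of finite sets $S_n\subseteq\omega^n$ such that $F\subseteq\{x\in\omega^\omega:(\exists^\infty n)(x\upharpoonright n\in S_n)\}$; this is a $\sigma$-ideal. For a $\sigma$-ideal $\mathcal{I}$, $\mathrm{cof}(\mathcal{I})=\min\{|\mathcal{A}|:\mathcal{A}\subseteq\mathcal{I}\wedge(\forall A\in\mathcal{I})(\exists B\in\mathcal{A})(A\subseteq B)\}$. $\mathfrak{d}=\min\{|\mathcal{F}|:\mathcal{F}\subseteq\omega^\omega\wedge(\forall x\in\omega^\omega)(\exists f\in\mathcal{F})(\forall^\infty n)(x(n)<f(n))\}$. *)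

(* Defs.v *)
From mathcomp Require Import all_boot.
From mathcomp Require Import mathcomp_extra boolp classical_sets functions.
From mathcomp Require Import cardinality.

Set Implicit Arguments.
Unset Strict Implicit.
Unset Printing Implicit Defensive.

Local Open Scope classical_set_scope.
Local Open Scope card_scope.

Definition of_least_card (T : Type) (P : set (set T)) : set (set T) :=
  [set A | P A /\ forall B, P B -> A #<= B].

(* The cardinal min {|A| : P A} is represented by a member of [P] of least   *)
(* cardinality, so cardinals are compared with [#<=].  By [min_cardP] the    *)
(* default value [set0] is never used when [P] is nonempty.                  *)
Definition min_card (T : Type) (P : set (set T)) : set T :=
  xget set0 (of_least_card P).

Lemma of_least_card_nonempty (T : Type) (P : set (set T)) :
  P !=set0 -> of_least_card P !=set0.
Proof.
move=> [P0 PP0].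
pose good (S : set (set T -> T)) :=
  (forall c A, S c -> P A -> A (c A)) /\
  (forall c d A, S c -> S d -> P A -> c A = d A -> c = d).
have [S [[Sin Sinj] Smax]] : exists S, good S /\
    forall S', S `<` S' -> ~ good S'.
  apply: Zorn_bigcup => F FG Ftot; split.
    by move=> c A [X FX Xc] PA; have [Xin _] := FG _ FX; exact: (Xin c A).
  move=> c d A [X FX Xc] [Y FY Yd] PA.
  case: (Ftot _ _ FX FY) => [XY|YX].
    by have [_ Yinj] := FG _ FY; apply: (Yinj _ _ A) => //; apply: XY.
  by have [_ Xinj] := FG _ FX; apply: (Xinj _ _ A) => //; apply: YX.
have [A [PA Asurj]] : exists A, P A /\ A `<=` (fun c => c A) @` S.
  apply: contrapT => noA.
  have ex A : P A -> exists a, A a /\ ~ ((fun c => c A) @` S) a.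
    move=> PA; apply: contrapT => noa; apply: noA; exists A; split => // a Aa.
    by apply: contrapT => nSa; apply: noa; exists a.
  have [t0 _] := ex _ PP0.
  have /choice[c cP] : forall A, exists a,
      P A -> A a /\ ~ ((fun c => c A) @` S) a.
    move=> A; have [PA|nPA] := pselect (P A); last by exists t0.
    by have [a aP] := ex _ PA; exists a.
  have Sc d A : S d -> P A -> d A <> c A.
    by move=> Sd PA dc; apply: (cP _ PA).2; exists d.
  apply: (Smax (S `|` [set c])).
    split; first by move=> d Sd; left.
    by move=> /(_ c (or_intror erefl)) /Sc/(_ PP0).
  split=> [d A [Sd|->] PA|d e A [Sd|->] [Se|->] PA de] //.
  - exact: (Sin d A).
  - exact: (cP _ PA).1.
  - exact: (Sinj _ _ A).
  - by case: (Sc _ _ Sd PA).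
  - by case: (Sc _ _ Se PA).
exists A; split => // B PB.
apply: (card_le_trans (subset_card_le Asurj)).
apply: (card_le_trans (card_image_le _ _)).
have SB : {in S &, injective (fun c : set T -> T => c B)}.
  by move=> c d /set_mem Sc /set_mem Sd; apply: Sinj.
rewrite -(card_le_eql (inj_card_eq SB)).
by apply: subset_card_le => _ [c Sc <-]; exact: (Sin c B).
Qed.

Lemma min_cardP (T : Type) (P : set (set T)) :
  P !=set0 -> of_least_card P (min_card P).
Proof. by move=> /of_least_card_nonempty; apply: xgetPex. Qed.

Definition restriction (x : nat -> nat) (n : nat) : n.-tuple nat :=
  [tuple x i | i < n].

Definition fN_Fin : set (set (nat -> nat)) :=
  [set F | exists S : forall n, set (n.-tuple nat),
    (forall n, finite_set (S n)) /\
    F `<=` [set x | infinite_set [set n | S n (restriction x n)]]].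

Definition cofinal_in (T : Type) (I : set (set T)) : set (set (set T)) :=
  [set C | C `<=` I /\ forall A, I A -> exists2 B, C B & A `<=` B].

Definition cof (T : Type) (I : set (set T)) : set (set T) :=
  min_card (cofinal_in I).

Definition dominating : set (set (nat -> nat)) :=
  [set D | forall x : nat -> nat,
    exists2 f, D f & cofinite_set [set n | x n < f n]].

Definition dominating_number : set (nat -> nat) := min_card dominating.

Lemma cofinal_in_nonempty (T : Type) (I : set (set T)) :
  cofinal_in I !=set0.
Proof. by exists I; split => // A IA; exists A. Qed.

Lemma dominating_nonempty : dominating !=set0.
Proof.
exists setT => x; exists (fun n => (x n).+1) => //.
by rewrite (_ : [set n | _] = setT) // -subTset => n _ /=.
Qed.

(* Main.v *)
Require Import Defs.
From mathcomp Require Import all_boot.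
From mathcomp Require Import mathcomp_extra boolp classical_sets functions.
From mathcomp Require Import cardinality.

(** A finite set of words of length [n] is contained in a cube of words with
    all letters at most some [k], and such cubes are themselves finite.  Hence
    a sequence [S] of finite sets of words may be replaced by a sequence of
    cubes, which is coded by a single function [f : nat -> nat] giving the
    bound at each length.  The set [io_bounded f] of those [x] that infinitely
    often have [x 0, ..., x (n-1)] all at most [f n] belongs to the ideal, and
    it grows with [f] along eventual domination, since finitely many lengths do
    not affect an infinitely-often condition.  So the [io_bounded f], for [f]
    in a dominating family [D], are cofinal in the ideal, and there are at most
    [#|D|] of them. *)

Local Open Scope classical_set_scope.
Local Open Scope card_scope.

Definition bounded_words (n k : nat) : set (n.-tuple nat) :=
  [set t | forall i, tnth t i <= k].

Definition io_bounded (f : nat -> nat) : set (nat -> nat) :=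
  [set x | infinite_set [set n | bounded_words n (f n) (restriction x n)]].

Lemma finite_bounded_words n k : finite_set (bounded_words n k).
Proof.
pose word (u : n.-tuple 'I_k.+1) : n.-tuple nat := map_tuple val u.
apply: (@sub_finite_set _ _ (range word)); last first.
  exact/finite_image/finite_finset.
move=> t tk; exists [tuple inord (tnth t i) | i < n] => //.
by apply: eq_from_tnth => i; rewrite tnth_map tnth_mktuple /= inordK // ltnS.
Qed.

Lemma finite_words_bounded n (A : set (n.-tuple nat)) :
  finite_set A -> exists k, A `<=` bounded_words n k.
Proof.
move=> /finite_seqP[s ->].
pose top (t : n.-tuple nat) := \max_(i < n) tnth t i.
exists (\max_(t <- s) top t) => t /= ts i.
apply: (@leq_trans (top t)); last exact: leq_bigmax_seq.
exact: leq_bigmax.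
Qed.

Lemma fN_Fin_io_bounded f : fN_Fin (io_bounded f).
Proof.
by exists (fun n => bounded_words n (f n)); split => // n;
  exact: finite_bounded_words.
Qed.

(** This is where eventual domination suffices: the lengths at which the
    containment fails form a finite set, which can be removed from any infinite
    set of lengths. *)
Lemma sub_io_bounded (S : forall n, set (n.-tuple nat)) (g f : nat -> nat) :
    (forall n, S n `<=` bounded_words n (g n)) ->
    cofinite_set [set n | g n < f n] ->
  [set x | infinite_set [set n | S n (restriction x n)]] `<=` io_bounded f.
Proof.
move=> Sg gf x /= infS fin_f; apply: (infinite_setD infS gf).
apply: sub_finite_set fin_f => n [Sn /contrapT /= /ltnW gfn] i.
exact: leq_trans (Sg _ _ Sn i) gfn.
Qed.

Lemma cofinal_io_bounded (D : set (nat -> nat)) :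
  dominating D -> cofinal_in fN_Fin (io_bounded @` D).
Proof.
move=> domD; split=> [_ [f _ <-]|F [S [finS FS]]].
  exact: fN_Fin_io_bounded.
have /choice[g Sg] n : exists k, S n `<=` bounded_words n k.
  exact: finite_words_bounded.
have [f Df gf] := domD g.
exists (io_bounded f); first by exists f.
exact: subset_trans FS (sub_io_bounded _ _ _ Sg gf).
Qed.

Theorem proposition22 : cof fN_Fin #<= dominating_number.
Proof.
have [domD _] := min_cardP dominating_nonempty.
have [_ cof_least] := min_cardP (cofinal_in_nonempty fN_Fin).
apply: card_le_trans (card_image_le io_bounded _).
exact/cof_least/cofinal_io_bounded.
Qed.
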